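(* Let $t=\{t_k\}_{k=1}^\infty$ be a non-increasing sequence of positive numbers, let $n\in\mathbb{N}$, $1\le q<\infty$ and $\varepsilon\ge 0$. If $$1-\varepsilon^q\sum_{k=1}^{n}\frac{1}{t_k^q}\ge 0,$$ set $m=n$. Otherwise let $m\in\mathbb{Z}_+$, $m\le n$, be such that $$1-\varepsilon^q\sum_{k=1}^{m}\frac{1}{t_k^q}\ge 0\qquad\text{and}\qquad 1-\varepsilon^q\sum_{k=1}^{m+1}\frac{1}{t_k^q}<0.$$ Then $$\mathcal{E}\left(W^T_q,I^n_{\varepsilon,\infty}\right)=\mathcal{E}\left(W^T_q,I^n_{\varepsilon,\infty},\Phi^*_m\right)=\left(t_{m+1}^q+\varepsilon^q\sum_{k=1}^m\left(1-\frac{t_{m+1}^q}{t_k^q}\right)\right)^{1/q}.$$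
   Context: $\ell_q$ is the space of complex sequences $x=\{x_k\}_{k=1}^\infty$ with the usual norm $\|x\|_q$. The class is $W^T_q=\{x=Th : h\in\ell_q,\ \|h\|_q\le 1\}$, where $Th=\{t_kh_k\}_{k=1}^\infty$. $\mathbb{Z}_+=\{0,1,2,\ldots\}$ and $\sum_{k=1}^0 a_k:=0$. Let $Z$ be a complex linear space, $W\subset\ell_q$, and let $I$ be an information mapping assigning to each $x\in\ell_q$ a non-empty subset $I(x)\subset Z$. A method of recovery is an arbitrary mapping $\Phi:Z\to\ell_q$. Its error is $\mathcal{E}(W,I,\Phi)=\sup_{x\in W}\sup_{a\in I(x)}\|x-\Phi(a)\|_q$, and the error of optimal recovery is $\mathcal{E}(W,I)=\inf_{\Phi}\mathcal{E}(W,I,\Phi)$, the infimum being over all methods $\Phi:Z\to\ell_q$. Here $Z=\mathbb{C}^n$ and $I^n_{\varepsilon,\infty}(x)=\{a\in\mathbb{C}^n:\max_{1\le k\le n}|x_k-a_k|\le\varepsilon\}$. For $1\le m\le n$, $$\Phi^*_m(a)=\left(a_1\Big(1-\frac{t_{m+1}^q}{t_1^q}\Big),\ldots,a_m\Big(1-\frac{t_{m+1}^q}{t_m^q}\Big),0,0,\ldots\right),$$ and $\Phi^*_0(a)$ is the zero sequence. *)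

(* Defs.v *)
From mathcomp Require Import all_boot all_order all_algebra.
From mathcomp Require Import all_classical all_reals all_analysis.
From mathcomp Require Export complex.

Set Implicit Arguments.
Unset Strict Implicit.
Unset Printing Implicit Defensive.

Import Order.TTheory GRing.Theory Num.Theory.
Import ComplexField.Normc.

#[local] Arguments normc {R} x.

Local Open Scope classical_set_scope.
Local Open Scope ring_scope.
Local Open Scope complex_scope.

(* Sequences are indexed from 0: the term written with index k >= 1 in the
   mathematical text is the value at k.-1. Hence [t m] below is t_(m+1), and a
   sum over 1 <= k <= m is a sum over k < m. *)

(* The l_q norm of an arbitrary complex sequence, +oo when the series of the
   |x_k|^q diverges. The modulus [normc] takes its values in R, not in R[i]. *)
Definition lqnorm (R : realType) (q : R) (x : nat -> R[i]) : \bar R :=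
  'N[counting]_(q%:E) [EFin \o normc \o x]%E.

Record lq (R : realType) (q : R) := Lq {
  lq_seq :> nat -> R[i];
  lq_fin : (lqnorm q lq_seq < +oo)%E
}.

Definition Wclass (R : realType) (q : R) (t : nat -> R) : set (lq q) :=
  [set x | exists2 h : lq q, (lqnorm q h <= 1)%E &
           forall k, x k = (t k)%:C * h k].
Arguments Wclass {R} q t.

Section OptimalRecovery.
Context {R : realType} {q : R} {Z : lmodType R[i]}.

(* Extended-real valued: the error of a method may be infinite. *)
Definition recovery_error (W : set (lq q)) (I : lq q -> set Z)
    (Phi : Z -> lq q) : \bar R :=
  ereal_sup [set ereal_sup [set lqnorm q (fun k => x k - Phi a k) | a in I x]
            | x in W].

Definition optimal_error (W : set (lq q)) (I : lq q -> set Z) : \bar R :=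
  ereal_inf [set recovery_error W I Phi | Phi in [set: Z -> lq q]].

End OptimalRecovery.

Definition info_sup (R : realType) (q : R) (n : nat) (eps : R) (x : lq q) :
    set 'rV[R[i]]_n :=
  [set a | \big[Num.max/0]_(k < n) normc (x k - a 0 k) <= eps].
Arguments info_sup {R q} n eps x.

Lemma info_sup_nonempty (R : realType) (q : R) (n : nat) (eps : R) (x : lq q) :
  0 <= eps -> info_sup n eps x !=set0.
Proof.
move=> eps0; exists (\row_(k < n) x k) => /=.
by apply: bigmax_le => // k _; rewrite mxE subrr normc0.
Qed.

Lemma lqnorm_finsupp (R : realType) (q : R) (x : nat -> R[i]) (N : nat) :
  0 < q -> (forall k, (N <= k)%N -> x k = 0) -> (lqnorm q x < +oo)%E.
Proof.
move=> q0 x0; rewrite /lqnorm Lnorm_counting//.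
rewrite (nneseries_split 0 N); last by move=> k _; exact: poweR_ge0.
rewrite eseries0 ?adde0; last first.
  move=> k; rewrite add0n => Nk _.
  by rewrite /= (x0 _ Nk) normc0 normr0 powR0// gt_eqF.
apply: poweR_lty; apply/lte_sum_pinfty => k _.
by apply: poweR_lty; rewrite abse_EFin ltry.
Qed.

(* The k-th coordinate of a for k < n, and 0 for k >= n. *)
Definition coord0 (R : realType) (n : nat) (a : 'rV[R[i]]_n) (k : nat) : R[i] :=
  if insub k is Some i then a 0 i else 0.

Definition Phistar_seq (R : realType) (q : R) (t : nat -> R) (n m : nat)
    (a : 'rV[R[i]]_n) (k : nat) : R[i] :=
  if (k < m)%N then coord0 a k * (1 - t m `^ q / t k `^ q)%:C else 0.

Lemma Phistar_fin (R : realType) (q : R) (t : nat -> R) (n m : nat)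
    (a : 'rV[R[i]]_n) :
  1 <= q -> (lqnorm q (Phistar_seq q t m a) < +oo)%E.
Proof.
move=> q1; apply: (@lqnorm_finsupp _ _ _ m); first exact: lt_le_trans q1.
by move=> k mk; rewrite /Phistar_seq ltnNge mk.
Qed.

Definition Phistar (R : realType) (q : R) (q1 : 1 <= q) (t : nat -> R)
    (n m : nat) (a : 'rV[R[i]]_n) : lq q :=
  Lq (Phistar_fin t m a q1).
Arguments Phistar {R q} q1 t n m a.

(* Main.v *)
Require Import Defs.
From mathcomp Require Import all_boot all_order all_algebra.
From mathcomp Require Import all_classical all_reals all_analysis.
From mathcomp Require Import ring lra.

Import Order.TTheory GRing.Theory Num.Theory.
Import ComplexField.Normc.
Local Open Scope ring_scope.

(** Put s_k = t_m^q / t_k^q for k < m, a number of [0, 1], and let V be the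
    claimed value, so that V^q = t_m^q + eps^q * sum_(k < m) (1 - s_k). The
    proof establishes V <= (optimal error) and (error of Phistar) <= V; as the
    optimal error is at most the error of Phistar, all three agree.

    Upper bound ([recovery_error_Phistar_le]). Let x = T h with |h|_q <= 1, and
    let a be some data for x. For k < m, the k-th coordinate of x - Phistar a
    is the convex combination (1 - s_k) (x_k - a_k) + s_k x_k, so by convexity
    of u |-> |u|^q its q-th power is at most
    (1 - s_k) eps^q + s_k |x_k|^q = (1 - s_k) eps^q + t_m^q |h_k|^q.
    For k >= m the coordinate is x_k, and |x_k|^q <= t_m^q |h_k|^q because t is
    non-increasing. Summation over k gives V^q. The weight s_k is thus chosen
    to make the factor of |h_k|^q independent of k.

    Lower bound ([lqnorm_le_optimal_error], [exists_extremal_seq]). If x and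
    -x both belong to the class and share the datum 0, no method can tell them
    apart, and its error is at least |x|_q. Such an x with |x|_q = V is
    (eps, ..., eps, w, 0, 0, ...), with eps in the first m places and w the
    largest number that keeps x in the class. If m < n, the coordinate
    w must also be invisible in the data, that is w <= eps: this is what the
    inequality satisfied by m + 1 says. *)

Set Implicit Arguments.
Unset Strict Implicit.

(** * The l_q norm and partial sums *)

Lemma normc_ge0 (R : realType) (z : R[i]%C) : 0 <= normc z.
Proof. by case: z => a b; exact: sqrtr_ge0. Qed.

Lemma normcR (R : realType) (r : R) : normc r%:C%C = `|r|.
Proof. by rewrite /normc/= expr0n addr0 sqrtr_sqr. Qed.

Lemma lqnormE (R : realType) (q : R) (x : nat -> R[i]%C) : 0 < q ->
  lqnorm q x = ((\sum_(0 <= k <oo) (normc (x k) `^ q)%:E) `^ q^-1)%E.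
Proof.
move=> q0; rewrite /lqnorm Lnorm_counting//; congr (_ `^ _)%E.
apply: eq_eseriesr => k _ /=.
by rewrite ger0_norm// normc_ge0.
Qed.

Lemma lqnorm_ge_sum (R : realType) (q : R) (x : nat -> R[i]%C) (N : nat) :
  0 < q -> (((\sum_(k < N) normc (x k) `^ q) `^ q^-1)%:E <= lqnorm q x)%E.
Proof.
move=> q0; rewrite lqnormE// -poweR_EFin.
have S0 k : (0 <= (normc (x k) `^ q)%:E)%E by rewrite lee_fin powR_ge0.
apply: gt0_ler_poweR.
- by rewrite invr_ge0 ltW.
- by rewrite in_itv/= leey lee_fin sumr_ge0// => k _; rewrite powR_ge0.
- by rewrite in_itv/= leey nneseries_ge0.
- by rewrite -sumEFin -(big_mkord xpredT (fun k => (normc (x k) `^ q)%:E))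
    nneseries_lim_ge.
Qed.

(** Requiring the bound only for large N allows an upper estimate that has an
    irregular initial segment to be summed exactly. *)
Lemma lqnorm_le_sum (R : realType) (q B : R) (x : nat -> R[i]%C) (M : nat) :
  0 < q -> 0 <= B ->
  (forall N, (M <= N)%N -> \sum_(k < N) normc (x k) `^ q <= B) ->
  (lqnorm q x <= (B `^ q^-1)%:E)%E.
Proof.
move=> q0 B0 HB; rewrite lqnormE// -poweR_EFin.
have S0 k : (0 <= (normc (x k) `^ q)%:E)%E by rewrite lee_fin powR_ge0.
apply: gt0_ler_poweR.
- by rewrite invr_ge0 ltW.
- by rewrite in_itv/= leey nneseries_ge0.
- by rewrite in_itv/= leey andbT lee_fin.
apply: lime_le; first exact: is_cvg_nneseries.
exists M => // N /= MN; rewrite big_mkord sumEFin lee_fin; exact: HB.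
Qed.

Lemma lqnorm_ge0 (R : realType) (q : R) (x : nat -> R[i]%C) :
  (0 <= lqnorm q x)%E.
Proof. exact: Lnorm_ge0. Qed.

(** Converse of [lqnorm_le_sum]; with it, estimates between norms reduce to
    estimates between finite sums of real numbers. *)
Lemma lqnorm_le_fin_sum (R : realType) (q c : R) (x : nat -> R[i]%C) (N : nat) :
  0 < q -> (lqnorm q x <= c%:E)%E ->
  \sum_(k < N) normc (x k) `^ q <= c `^ q.
Proof.
move=> q0 xc.
have c0 : 0 <= c by rewrite -lee_fin (le_trans (lqnorm_ge0 q x)).
have S0 : 0 <= \sum_(k < N) normc (x k) `^ q.
  by rewrite sumr_ge0// => k _; rewrite powR_ge0.
have := le_trans (lqnorm_ge_sum x N q0) xc; rewrite lee_fin => Sc.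
rewrite -[leLHS]powRr1// -(@mulVf _ q) ?gt_eqF// powRrM.
by apply: ge0_ler_powR => //; rewrite ?nnegrE ?powR_ge0// ltW.
Qed.

Lemma lqnorm_finsuppE (R : realType) (q : R) (x : nat -> R[i]%C) (M : nat) :
  0 < q -> (forall k, (M <= k)%N -> x k = 0) ->
  lqnorm q x = ((\sum_(k < M) normc (x k) `^ q) `^ q^-1)%:E.
Proof.
move=> q0 x0; apply/eqP; rewrite eq_le lqnorm_ge_sum// andbT.
apply: (@lqnorm_le_sum _ _ _ _ M) => //.
  by rewrite sumr_ge0// => k _; rewrite powR_ge0.
move=> N MN; rewrite -!(big_mkord xpredT (fun k => normc (x k) `^ q)).
rewrite (big_cat_nat _ MN)//= gerDl big_nat_cond big1// => k.
by rewrite andbT => /andP[Mk _]; rewrite x0// normc0 powR0// gt_eqF.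
Qed.

(** Convexity of z |-> |z|^q on the complex plane, inherited from that of
    r |-> r^q through the triangle inequality. The convex combination is written
    as a displacement from u towards v, the form in which it arises below. *)
Lemma powR_normc_convex (R : realType) (q s : R) (u v : R[i]%C) :
  1 <= q -> 0 <= s <= 1 ->
  normc (u + s%:C%C * (v - u)) `^ q <=
    (1 - s) * normc u `^ q + s * normc v `^ q.
Proof.
move=> q1 /andP[s0 s1].
have q0 : 0 <= q by exact: le_trans q1.
have s1' : 0 <= 1 - s by rewrite subr_ge0.
have -> : u + s%:C%C * (v - u) = (1 - s)%:C%C * u + s%:C%C * v.
  by rewrite rmorphB rmorph1; ring.
apply: (@le_trans _ _ (((1 - s) * normc u + s * normc v) `^ q)).
  apply: ge0_ler_powR => //; rewrite ?nnegrE ?normc_ge0//.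
    by rewrite addr_ge0// mulr_ge0// normc_ge0.
  by rewrite (le_trans (le_normcD _ _))// !normcM !normcR !ger0_norm.
have := @convex_powR _ q q1 (Itv01 s0 s1) (normc v) (normc u).
rewrite !inE/= !in_itv/= !normc_ge0 => /(_ isT isT).
by rewrite [conv _ _ _]convRE !convRE/= addrC [leRHS]addrC.
Qed.

(** * The error of the method Phistar *)

(** The multiplier 1 - s_k makes the error in place k < m a convex combination
    of the data error and of x_k itself. Since s_k t_k^q = t_m^q, the latter
    contributes t_m^q |h_k|^q, the same bound as in the discarded places. *)
Lemma recovery_error_Phistar_le (R : realType) (q eps : R) (t : nat -> R)
    (n m : nat) (q1 : 1 <= q) :
  (forall k, 0 < t k) -> nonincreasing_seq t -> (m <= n)%N ->
  (recovery_error (Wclass q t) (info_sup n eps) (Phistar q1 t n m) <=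
    ((t m `^ q + eps `^ q * \sum_(k < m) (1 - t m `^ q / t k `^ q))
       `^ q^-1)%:E)%E.
Proof.
move=> t0 tn mn; have q0 : 0 < q by exact: lt_le_trans q1.
have tq0 k : 0 < t k `^ q by exact: powR_gt0.
have tqm k l : (k <= l)%N -> t l `^ q <= t k `^ q.
  move=> kl; apply: ge0_ler_powR; rewrite ?nnegrE ?(ltW (t0 _))//.
    exact: ltW.
  exact: tn.
have s01 k : (k <= m)%N -> 0 <= t m `^ q / t k `^ q <= 1.
  move=> km; rewrite divr_ge0 ?powR_ge0//=.
  by rewrite ler_pdivrMr// mul1r tqm.
apply: ge_ereal_sup => _ [x [h h1 xE] <-].
apply: ge_ereal_sup => _ [a /bigmax_leP[eps0 xa] <-].
apply: (@lqnorm_le_sum _ _ _ _ m) => // [|N mN].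
  rewrite addr_ge0 ?powR_ge0// mulr_ge0 ?powR_ge0// sumr_ge0// => k _.
  by have /andP[_] := s01 k (ltnW (ltn_ord k)); rewrite subr_ge0.
have xh k : normc (x k) `^ q = t k `^ q * normc (h k) `^ q.
  by rewrite xE normcM normcR ger0_norm ?(ltW (t0 _))// powRM ?normc_ge0// ltW.
apply: (@le_trans _ _ (\sum_(k < N) (t m `^ q * normc (h k) `^ q +
   if (k < m)%N then eps `^ q * (1 - t m `^ q / t k `^ q) else 0))).
  apply: ler_sum => -[k kN] _ /=; rewrite /Phistar_seq.
  have [km|mk] := ltnP k m; last first.
    by rewrite subr0 addr0 xh ler_wpM2r ?powR_ge0// tqm.
  set s := t m `^ q / t k `^ q.
  have kn : (k < n)%N by exact: leq_trans mn.
  rewrite /Defs.coord0 insubT.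
  set b := a 0 _.
  have xb : normc (x k - b) <= eps by have := xa (Ordinal kn) isT.
  have -> : x k - b * (1 - s)%:C%C = x k - b + s%:C%C * (x k - (x k - b)).
    by rewrite rmorphB rmorph1; ring.
  apply: le_trans (powR_normc_convex _ _ q1 (s01 _ (ltnW km))) _.
  rewrite -/s xh mulrA divfK ?gt_eqF// addrC lerD2l mulrC ler_wpM2r//.
    by have /andP[_] := s01 k (ltnW km); rewrite subr_ge0.
  by apply: ge0_ler_powR; rewrite ?nnegrE ?normc_ge0 ?(ltW q0).
rewrite big_split/= -mulr_sumr -big_mkcond/= -(big_ord_widen _
  (fun k => eps `^ q * (1 - t m `^ q / t k `^ q)) mN) -mulr_sumr lerD2r.
rewrite ler_piMr ?(ltW (tq0 _))//.
rewrite [leRHS](_ : 1 = 1 `^ q); last by rewrite powR1.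
exact: lqnorm_le_fin_sum.
Qed.

(** * The lower bound for arbitrary methods *)

Lemma recovery_error_ge (R : realType) (q : R) (Z : lmodType R[i]%C)
    (W : set (lq q)) (I : lq q -> set Z) (Phi : Z -> lq q) (x : lq q) (a : Z) :
  W x -> I x a ->
  (lqnorm q (fun k => x k - Phi a k)%R <= recovery_error W I Phi)%E.
Proof.
move=> Wx Ia; rewrite /recovery_error.
apply: (@le_trans _ _ (ereal_sup
  [set lqnorm q (fun k => x k - Phi a k)%R | a in I x])).
  by apply: ereal_sup_ubound; exists a.
by apply: ereal_sup_ubound; exists x.
Qed.

(** From the datum a common to x and -x, a method returns one sequence phi. As
    x is the midpoint of x - phi and x + phi, convexity bounds |x|_q by the
    larger of the two errors |x - phi|_q and |-x - phi|_q. The sequence -x is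
    the argument y because an element of [lq] bundles its summability. *)
Lemma lqnorm_le_optimal_error (R : realType) (q : R) (Z : lmodType R[i]%C)
    (W : set (lq q)) (I : lq q -> set Z) (x y : lq q) (a : Z) :
  1 <= q -> (forall k, y k = - x k) -> W x -> W y -> I x a -> I y a ->
  (lqnorm q x <= optimal_error W I)%E.
Proof.
move=> q1 yx Wx Wy Ix Iy; have q0 : 0 < q by exact: lt_le_trans q1.
apply: le_ereal_inf_tmp => _ [Phi _ <-].
have := recovery_error_ge Phi Wy Iy; have := recovery_error_ge Phi Wx Ix.
case: (recovery_error W I Phi) => [c| |].
- move=> xc yc.
  have c0 : 0 <= c by rewrite -lee_fin (le_trans _ xc)// lqnorm_ge0.
  rewrite -(powRr1 c0) -(@mulfV _ q) ?gt_eqF// powRrM.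
  apply: (@lqnorm_le_sum _ _ _ _ 0) => // [|N _]; first exact: powR_ge0.
  have h1 : 0 <= (2^-1 : R) <= 1 by lra.
  apply: (@le_trans _ _ (\sum_(k < N) ((1 - 2^-1) * normc (x k - Phi a k) `^ q
                           + 2^-1 * normc (y k - Phi a k) `^ q))).
    apply: ler_sum => k _.
    have -> : normc (y k - Phi a k) = normc (x k + Phi a k).
      by rewrite yx -normcN opprD !opprK.
    apply: le_trans (powR_normc_convex _ _ q1 h1).
    suff {1}-> : x k = x k - Phi a k +
        (2^-1)%:C%C * (x k + Phi a k - (x k - Phi a k)) by rewrite lexx.
    by rewrite fmorphV rmorph_nat; field.
  rewrite big_split/= -!mulr_sumr.
  have := lqnorm_le_fin_sum N q0 xc; have := lqnorm_le_fin_sum N q0 yc; lra.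
- by move=> _ _; exact: leey.
- by move=> /(le_trans (lqnorm_ge0 _ _)).
Qed.

Lemma Wclass_finsupp (R : realType) (q : R) (t : nat -> R)
    (c : nat -> R[i]%C) (M : nat) :
  0 < q -> (forall k, 0 < t k) -> (forall k, (M <= k)%N -> c k = 0) ->
  \sum_(k < M) normc (c k) `^ q / t k `^ q <= 1 ->
  exists2 x : lq q, lq_seq x = c & Wclass q t x.
Proof.
move=> q0 t0 cM c1; exists (Lq (lqnorm_finsupp q0 cM)) => //.
pose h k : R[i]%C := (t k)^-1%:C%C * c k.
have hM k : (M <= k)%N -> h k = 0 by move=> Mk; rewrite /h cM// mulr0.
exists (Lq (lqnorm_finsupp q0 hM)) => /= [|k].
  rewrite (lqnorm_finsuppE q0 hM) lee_fin.
  rewrite [leRHS](_ : 1 = 1 `^ q^-1); last by rewrite powR1.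
  apply: ge0_ler_powR; rewrite ?nnegrE ?invr_ge0// ?(ltW q0)//.
    by rewrite sumr_ge0// => k _; rewrite powR_ge0.
  apply: le_trans c1; apply: ler_sum => k _.
  rewrite /h normcM normcR ger0_norm ?invr_ge0 ?(ltW (t0 _))//.
  rewrite powRM ?normc_ge0 ?invr_ge0 ?(ltW (t0 _))// mulrC.
  by rewrite -(powR_inv1 (ltW (t0 k))) -powRrM mulN1r powRN.
by rewrite /h mulrA -rmorphM mulfV ?gt_eqF// rmorph1 mul1r.
Qed.

(** The sequence is (eps, ..., eps, w, 0, ...) with w in place m. The second
    condition says that it lies on the boundary of the class, and fixes w:
    w^q = t_m^q (1 - eps^q S), S being the sum of the 1 / t_k^q over k < m. *)
Lemma exists_extremal_seq (R : realType) (q eps : R) (t : nat -> R)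
    (n m : nat) :
  1 <= q -> 0 <= eps -> (forall k, 0 < t k) ->
  0 <= 1 - eps `^ q * \sum_(k < m) 1 / t k `^ q ->
  ((m < n)%N -> 1 - eps `^ q * \sum_(k < m.+1) 1 / t k `^ q <= 0) ->
  exists c : nat -> R[i]%C,
    [/\ forall k, (m < k)%N -> c k = 0,
        \sum_(k < m.+1) normc (c k) `^ q / t k `^ q = 1,
        forall k, (k < n)%N -> normc (c k) <= eps
      & \sum_(k < m.+1) normc (c k) `^ q =
        t m `^ q + eps `^ q * \sum_(k < m) (1 - t m `^ q / t k `^ q)].
Proof.
move=> q1 eps0 t0 S0 S1; have q0 : 0 < q by exact: lt_le_trans q1.
have tq0 k : 0 < t k `^ q by exact: powR_gt0.
set S := \sum_(k < m) _ in S0.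
pose w := (t m `^ q * (1 - eps `^ q * S)) `^ q^-1.
have w0 : 0 <= w by exact: powR_ge0.
have wq : w `^ q = t m `^ q * (1 - eps `^ q * S).
  by rewrite -powRrM mulVf ?gt_eqF// powRr1// mulr_ge0// ltW.
clearbody w.
pose r k := if (k < m)%N then eps else if k == m then w else 0.
have r0 k : 0 <= r k by rewrite /r; case: ifP => // _; case: ifP.
pose c k : R[i]%C := (r k)%:C%C.
have nr k : normc (c k) = r k by rewrite normcR ger0_norm.
have rm : r m = w by rewrite /r ltnn eqxx.
have rlt k : (k < m)%N -> r k = eps by rewrite /r => ->.
have rgt k : (m < k)%N -> r k = 0.
  by move=> mk; rewrite /r ltnNge (ltnW mk)/= gtn_eqF.
have cgt k : (m < k)%N -> c k = 0 by move=> /rgt rk; rewrite /c rk.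
clearbody r c.
exists c; split => //.
- rewrite big_ord_recr/= nr rm wq mulrAC divff ?gt_eqF// mul1r.
  rewrite (eq_bigr (fun k : 'I_m => eps `^ q * (1 / t k `^ q))) => [|k _].
    by rewrite -mulr_sumr -/S addrC subrK.
  by rewrite nr rlt// mul1r.
- move=> k kn; rewrite nr; have [/rlt->|/rgt->|km] := ltngtP k m => //.
  rewrite km rm.
  (* w^q <= eps^q is the inequality S1 multiplied by t_m^q. *)
  have wqe : w `^ q <= eps `^ q.
    move: (S1 ltac:(by rewrite -km)).
    rewrite big_ord_recr/= -/S mulrDr opprD addrA subr_le0 mulrA mulr1.
    by rewrite ler_pdivlMr// mulrC wq.
  have := ge0_ler_powR (r := q^-1).
  rewrite invr_ge0 (ltW q0) => /(_ isT (w `^ q) (eps `^ q)).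
  rewrite !nnegrE !powR_ge0 => /(_ isT isT wqe).
  by rewrite -!powRrM mulfV ?gt_eqF// !powRr1.
rewrite big_ord_recr/= nr rm wq.
rewrite (eq_bigr (fun=> eps `^ q)) => [|k _]; last by rewrite nr rlt.
rewrite sumr_const card_ord big_split/= sumrN sumr_const card_ord.
have -> : \sum_(k < m) t m `^ q / t k `^ q = t m `^ q * S.
  by rewrite mulr_sumr; apply: eq_bigr => k _; rewrite div1r.
by rewrite -(mulr_natr _ m) -(mulr_natr 1 m); ring.
Qed.

Unset Implicit Arguments.

Theorem theorem2 (R : realType) (t : nat -> R) (n : nat) (q eps : R)
    (t_gt0 : forall k, 0 < t k) (t_noninc : nonincreasing_seq t)
    (n_gt0 : (0 < n)%N) (q_ge1 : 1 <= q) (eps_ge0 : 0 <= eps) (m : nat)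
    (hm : if 0 <= 1 - eps `^ q * \sum_(k < n) 1 / t k `^ q then m = n
          else [/\ (m <= n)%N,
                   0 <= 1 - eps `^ q * \sum_(k < m) 1 / t k `^ q
                 & 1 - eps `^ q * \sum_(k < m.+1) 1 / t k `^ q < 0]) :
  optimal_error (Wclass q t) (info_sup n eps) =
    recovery_error (Wclass q t) (info_sup n eps) (Phistar q_ge1 t n m) /\
  recovery_error (Wclass q t) (info_sup n eps) (Phistar q_ge1 t n m) =
    ((t m `^ q + eps `^ q * \sum_(k < m) (1 - t m `^ q / t k `^ q))
       `^ q^-1)%:E.
Proof.
have q0 : 0 < q by exact: lt_le_trans q_ge1.
have [mn Sm_ge0 Sm1_le0] : [/\ (m <= n)%N,
    0 <= 1 - eps `^ q * \sum_(k < m) 1 / t k `^ q &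
    (m < n)%N -> 1 - eps `^ q * \sum_(k < m.+1) 1 / t k `^ q <= 0].
  (* For m = n, place m is not observed and nothing limits w by eps. *)
  case: ifP hm => [Sn_ge0 ->|_ [mn Sm Sm1]]; first by rewrite ltnn.
  by split=> // _; exact: ltW.
have upper := recovery_error_Phistar_le eps q_ge1 t_gt0 t_noninc mn.
set V := (_ `^ q^-1)%:E in upper *.
have opt_le : (optimal_error (Wclass q t) (info_sup n eps) <=
    recovery_error (Wclass q t) (info_sup n eps) (Phistar q_ge1 t n m))%E.
  by apply: ereal_inf_lbound; exists (Phistar q_ge1 t n m).
have lower : (V <= optimal_error (Wclass q t) (info_sup n eps))%E.
  have [c [c_supp c_W c_eps cV]] :=
    exists_extremal_seq q_ge1 eps_ge0 t_gt0 Sm_ge0 Sm1_le0.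
  have Nc_supp k : (m < k)%N -> - c k = 0 by move=> /c_supp ->; rewrite oppr0.
  have [x xc Wx] := Wclass_finsupp q0 t_gt0 c_supp ltac:(by rewrite c_W).
  have [y yc Wy] : exists2 y : lq q, lq_seq y = (fun k => - c k) & Wclass q t y.
    apply: (Wclass_finsupp (M := m.+1)) => //.
    by under eq_bigr do rewrite normcN; rewrite c_W.
  have info0 (z : lq q) : (forall k, normc (z k) = normc (c k)) ->
      info_sup n eps z 0.
    move=> zc; apply: bigmax_le => // k _.
    by rewrite mxE subr0 zc c_eps.
  rewrite /V -cV -(lqnorm_finsuppE q0 c_supp) -xc.
  apply: (lqnorm_le_optimal_error (y := y) (a := 0)) => //.
  - by move=> k; rewrite yc xc.
  - by apply: info0 => k; rewrite xc.
  - by apply: info0 => k; rewrite yc normcN.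
have opt_ge := le_trans upper lower.
by split; apply/eqP; rewrite eq_le ?opt_le ?upper ?(le_trans lower).
Qed.
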